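(* Let $k\ge 2$ and let $m_i,n_i$ ($1\le i\le k$) be integers with $0<m_i\le n_i$ and $\gcd(m_i,n_i)=1$. Let $L=M\left(\frac{m_1}{n_1},\dots,\frac{m_k}{n_k}\right)$ be the corresponding standard alternating Montesinos diagram, and suppose that it is a diagram of a prime link and has no nugatory crossings. Then different arcs of $L$ represent different elements of $H_1(M_L^{(2)},\mathbb{Z})$, where $M_L^{(2)}$ is the double cover of $S^3$ branched along $L$.
   Context: Rational tangles: a tangle diagram has four ends NW, NE, SW, SE. For a positive integer $a$, the integer tangle $a$ is a horizontal row of $a$ half-twists (two horizontal strands twisted around each other with $a$ crossings side by side) in which at every crossing the overcrossing strand runs from lower left to upper right. The sum $T+T'$ places $T'$ to the right of $T$, joining the NE and SE ends of $T$ to the NW and SW ends of $T'$. The tangle $1/T$ is obtained from $T$ by reflecting in the plane perpendicular to the projection plane through the NW–SE diagonal (over-strands remain over-strands), so that $1/n$ is a vertical column of $n$ crossings. For coprime positive integers $m,n$, the rational $\frac{m}{n}$-tangle is built according to a continued fraction $$\frac{m}{n}=a_r+\cfrac{1}{a_{r-1}+\cdots+\cfrac{1}{a_1}},$$ with $a_1,\dots,a_{r-1}>0$ and $a_r\ge 0$: start from the integer tangle $a_1$, invert and add $a_2$, invert and add $a_3$, and so on, finishing by adding $a_r$ (nothing is added if $a_r=0$). Montesinos diagram: $M\left(\frac{m_1}{n_1},\dots,\frac{m_k}{n_k}\right)$ is obtained by placing the rational tangles $\frac{m_1}{n_1},\dots,\frac{m_k}{n_k}$ side by side from left to right, joining the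 NE end of the $i$-th tangle to the NW end of the $(i+1)$-st by a maximum and the SE end of the $i$-th to the SW end of the $(i+1)$-st by a minimum ($1\le i\le k-1$), and joining the NE (respectively SE) end of the $k$-th tangle to the NW (respectively SW) end of the first by an outer arc. With $m_i,n_i>0$ this diagram is alternating. (The pretzel diagram $P(n_1,\dots,n_k)$ with all $n_i>0$ is the case in which all $m_i=1$.) An arc of a diagram is a maximal piece of the diagram running from an undercrossing to the next undercrossing. A nugatory crossing is a crossing $c$ such that some simple closed curve in the projection sphere meets the diagram only at $c$, passing through it transversally (separating the diagram into two parts). Elements represented by arcs: let $Col(L)$ be the abelian group generated by the arcs of the diagram $L$, with one relation $2a-b-c=0$ for each crossing, where $a$ is the overcrossing arc and $b,c$ are the undercrossing arcs. Then $Col(L)\cong H_1(M_L^{(2)},\mathbb{Z})\oplus\mathbb{Z}$, and choosing one arc $a_0$ of $L$ and setting it equal to $0$ gives a group $Col(L)/\langle a_0\rangle$ identified with $H_1(M_L^{(2)},\mathbb{Z})$. The element of $H_1(M_L^{(2)},\mathbb{Z})$ represented by an arc is its image in this quotient (whether two arcs represent the same element does not depend on the choice of $a_0$). *)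

(* Defs.v *)
From HB Require Import structures.
From mathcomp Require Import all_boot all_order all_algebra ring_quotient.
From mathcomp Require Import boolp.
From Stdlib Require Import Relation_Operators.

Set Implicit Arguments.
Unset Strict Implicit.
Unset Printing Implicit Defensive.

Import GRing.Theory.

(* Unoriented link diagrams on the sphere, as planar diagram codes.  The edges
   of the diagram are labelled by natural numbers.
   - [X a b c d] is a crossing whose four incident edges are, in
     counterclockwise order, a, b, c, d; the strand a-c passes under the strand
     b-d.
   - [P a b] is a bivalent point of the diagram, joining the edges a and b end
     to end; [P a a] is a circle without crossings. *)
Inductive node := X of nat & nat & nat & nat | P of nat & nat.

Definition node_code (v : node) : nat * nat * nat * nat + nat * nat :=
  match v with X a b c d => inl (a, b, c, d) | P a b => inr (a, b) end.
Definition node_decode (s : nat * nat * nat * nat + nat * nat) : node :=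
  match s with inl (a, b, c, d) => X a b c d | inr (a, b) => P a b end.
Lemma node_codeK : cancel node_code node_decode. Proof. by case. Qed.
HB.instance Definition _ := Equality.copy node (can_type node_codeK).

Definition pd := seq node.

Definition slots (v : node) : seq nat :=
  match v with X a b c d => [:: a; b; c; d] | P a b => [:: a; b] end.
Definition is_crossing (v : node) : bool := if v is X _ _ _ _ then true else false.
Definition labels (D : pd) : seq nat := flatten [seq slots v | v <- D].

Definition relabel_node (f : nat -> nat) (v : node) : node :=
  match v with
  | X a b c d => X (f a) (f b) (f c) (f d)
  | P a b => P (f a) (f b)
  end.
Definition relabel (f : nat -> nat) (D : pd) : pd := [seq relabel_node f v | v <- D].

Section CombinatorialMap.
Variable D : pd.

Definition node_at (i : 'I_(size D)) : node := tnth (in_tuple D) i.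

(* A dart is a half-edge: a node together with one of its slots. *)
Definition dart : finType := {i : 'I_(size D) & 'I_(size (slots (node_at i)))}.

Definition node_of (d : dart) : node := node_at (tag d).
Definition label (d : dart) : nat := nth 0 (slots (node_of d)) (tagged d).
Definition at_crossing (d : dart) : bool := is_crossing (node_of d).
Definition under (d : dart) : bool := at_crossing d && ~~ odd (tagged d).
Definition over (d : dart) : bool := at_crossing d && odd (tagged d).

(* The next dart counterclockwise, respectively clockwise, around the node. *)
Definition rot_ccw (d : dart) : dart := Tagged _ (ordS (tagged d)).
Definition rot_cw (d : dart) : dart := Tagged _ (ord_pred (tagged d)).
(* The dart on the same strand at the other side of the node. *)
Definition across (d : dart) : dart :=
  if at_crossing d then rot_ccw (rot_ccw d) else rot_ccw d.

Definition opp (d : dart) : dart :=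
  odflt d [pick e | (e != d) && (label e == label d)].

(* The orbits of [face] are the boundary walks of the regions; the orbit of d is
   the walk that leaves the node along d with the region on its left, so it
   passes through the corner between d and [rot_ccw d]. *)
Definition face (d : dart) : dart := rot_cw (opp d).

Definition linked : rel dart :=
  [rel d e | [|| label d == label e, e == rot_ccw d | d == rot_ccw e]].

(* Every label occurs exactly twice, i.e. is an edge with two ends. *)
Definition well_formed : bool :=
  all (fun x => count_mem x (labels D) == 2) (labels D).

(* Euler's formula V - E + F = 2 C, i.e. every component has genus 0. *)
Definition planar : bool :=
  size D + fcard face {: dart} == #|{: dart}|./2 + (n_comp linked {: dart}).*2.

Definition is_diagram : bool := well_formed && planar.

(* A crossing is nugatory when two of its opposite corners lie in the same
   region, so that a simple closed curve can run inside that region from one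
   corner to the other and then pass transversally through the crossing.  The
   regions are the face orbits when the diagram is connected. *)
Definition nugatory (d : dart) : bool :=
  at_crossing d && fconnect face d (rot_ccw (rot_ccw d)).
Definition has_nugatory_crossing : bool := [exists d, nugatory d].

(* The arcs, as sets of half-edges: two half-edges are in the same arc when one
   can go from one to the other along edges, through bivalent points and through
   overcrossings. *)
Definition strand : rel dart :=
  [rel d e | (label d == label e)
          || ~~ under d && (e == across d) || ~~ under e && (d == across e)].
Definition arc_set (d : dart) : {set dart} := [set e | connect strand d e].
Definition arcs : {set {set dart}} := [set arc_set d | d : dart].
Definition Arc : finType := {A : {set dart} | A \in arcs}.
Lemma arc_set_in (d : dart) : arc_set d \in arcs. Proof. exact: imset_f. Qed.
Definition arc_of (d : dart) : Arc := exist _ (arc_set d) (arc_set_in d).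

End CombinatorialMap.

Section QuotientBySpan.
Local Open Scope ring_scope.
Variables (V : zmodType) (I : finType) (g : I -> V).

Definition zspan : {pred V} :=
  fun x => `[< exists c : I -> int, x = \sum_i g i *~ c i >].

Lemma zspan_zmod_closed : zmod_closed zspan.
Proof.
split.
  by apply/asboolP; exists (fun=> 0); rewrite big1.
move=> _ _ /asboolP [c ->] /asboolP [c' ->]; apply/asboolP.
exists (fun i => c i - c' i); rewrite -sumrB.
by apply: eq_bigr => i _; rewrite mulrzBr.
Qed.
HB.instance Definition _ := GRing.isZmodClosed.Build V zspan zspan_zmod_closed.

(* The quotient of V by the subgroup generated by the family g. *)
Definition span_quot : zmodType := Quotient.quot zspan.
Definition span_proj (x : V) : span_quot := (\pi_(Quotient.quot zspan) x)%qT.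
End QuotientBySpan.

Section ColoringGroup.
Local Open Scope ring_scope.
Variable D : pd.

Definition free_gen (a : Arc D) : {ffun Arc D -> int} := [ffun b => (a == b)%:R].

(* For an undercrossing dart d, [across d] is the other undercrossing dart and
   [rot_ccw d] is on the overcrossing arc. *)
Definition crossing_relation (d : {d : dart D | under d}) : {ffun Arc D -> int} :=
  free_gen (arc_of (rot_ccw (val d))) *+ 2
    - free_gen (arc_of (val d)) - free_gen (arc_of (across (val d))).

Definition Col : zmodType := span_quot crossing_relation.
Definition col_elt (a : Arc D) : Col := span_proj crossing_relation (free_gen a).

(* H_1(M_D^(2), Z), as the quotient of Col(D) by the class of a base arc. *)
Definition H1_dbc (a0 : Arc D) : zmodType := span_quot (fun _ : unit => col_elt a0).
Definition arc_elt (a0 a : Arc D) : H1_dbc a0 :=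
  span_proj (fun _ : unit => col_elt a0) (col_elt a).
End ColoringGroup.

(* Local moves, oriented in one direction. *)
Inductive local_move : pd -> pd -> Prop :=
| Rotate a b c d : local_move [:: X a b c d] [:: X c d a b]
| Flip a b : local_move [:: P a b] [:: P b a]
| R1_left a b c : local_move [:: X a a b c] [:: P b c]
| R1_right a b c : local_move [:: X b a a c] [:: P b c]
(* The under strand u0-u1-u2 and the over strand o0-o1-o2 bound the bigon with
   sides u1 and o1. *)
| R2 u0 u1 u2 o0 o1 o2 :
    local_move [:: X u0 o1 u1 o0; X u1 o1 u2 o2] [:: P u0 u2; P o0 o2]
(* The top, middle and bottom strands t0-t1-t2, m0-m1-m2, b0-b1-b2 bound the
   triangle with sides t1, m1, b1; the ends of the three strands follow each
   other counterclockwise in the order t0, m0, b0, t2, m2, b2 in the first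
   version, and t0, b0, m0, t2, b2, m2 in the second one. *)
| R3_tmb t0 t1 t2 m0 m1 m2 b0 b1 b2 :
    local_move [:: X b0 m1 b1 m0; X b1 t1 b2 t0; X m1 t2 m2 t1]
               [:: X b1 m2 b2 m1; X b0 t2 b1 t1; X m0 t1 m1 t0]
| R3_tbm t0 t1 t2 m0 m1 m2 b0 b1 b2 :
    local_move [:: X b0 m0 b1 m1; X m1 t1 m2 t0; X b1 t2 b2 t1]
               [:: X b1 m1 b2 m2; X m0 t2 m1 t1; X b0 t1 b1 t0].

(* Changes of code that do not change the diagram, and Reidemeister moves. *)
Inductive code_move : pd -> pd -> Prop :=
| move_perm D D' : perm_eq D D' -> code_move D D'
| move_relabel f D : injective f -> code_move D (relabel f D)
| move_absorb a b D : a != b ->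
    code_move (P a b :: D) (relabel (fun x => if x == b then a else x) D)
| move_local D D' E : local_move D D' -> code_move (D ++ E) (D' ++ E).

(* All the intermediate codes are required to be diagrams on the sphere. *)
Definition diagram_move (D D' : pd) : Prop :=
  [/\ is_diagram D, is_diagram D' & code_move D D'].

(* Two diagrams represent the same link. *)
Definition same_link : pd -> pd -> Prop := clos_refl_sym_trans pd diagram_move.

Definition trivial_knot (D : pd) : Prop := same_link D [:: P 0 0].

(* D is obtained by cutting an edge of D1 and an edge of D2 (at bivalent points)
   and joining the ends of the first to the ends of the second. *)
Definition connected_sum (D1 D2 D : pd) : Prop :=
  exists a b c d E1 E2,
    [/\ D1 = P a b :: E1, D2 = P c d :: E2,
        ~~ has (mem (labels D1)) (labels D2)
      & D = [:: P a c, P b d & E1 ++ E2]].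

(* D is a diagram of a link that is not the trivial knot and is not the
   connected sum of two links both different from the trivial knot. *)
Definition represents_prime_link (D : pd) : Prop :=
  ~ trivial_knot D /\
  forall D1 D2 D' : pd, is_diagram D1 -> is_diagram D2 ->
    connected_sum D1 D2 D' -> same_link D D' ->
    trivial_knot D1 \/ trivial_knot D2.

(* A tangle diagram: nodes, and the labels of the edges at the four ends. *)
Record tangle := Tangle { nodes : pd; NW : nat; NE : nat; SW : nat; SE : nat }.

(* The i-th crossing has its left edges labelled 2i (upper) and 2i+1 (lower), and
   its right edges 2i+2 (upper) and 2i+3 (lower). *)
Definition int_tangle (a : nat) : tangle :=
  Tangle [seq X i.*2 i.*2.+1 i.*2.+3 i.*2.+2 | i <- iota 0 a] 0 a.*2 1 a.*2.+1.

(* Relabelling the left summand by even numbers and the right one by odd numbers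
   makes the labels disjoint. *)
Definition lft (x : nat) : nat := x.*2.
Definition rgt (x : nat) : nat := x.*2.+1.
Definition tangle_sum (T T' : tangle) : tangle :=
  Tangle ([:: P (lft (NE T)) (rgt (NW T')), P (lft (SE T)) (rgt (SW T'))
           & relabel lft (nodes T) ++ relabel rgt (nodes T')])
         (lft (NW T)) (rgt (NE T')) (lft (SW T)) (rgt (SE T')).

(* 1/T: the reflection reverses the cyclic orders, keeps the over strands, and
   exchanges NE and SW. *)
Definition reflect_node (v : node) : node :=
  match v with X a b c d => X a d c b | P a b => P a b end.
Definition tangle_inv (T : tangle) : tangle :=
  Tangle [seq reflect_node v | v <- nodes T] (NW T) (SW T) (NE T) (SE T).

Definition add_int (T : tangle) (a : nat) : tangle :=
  if a == 0 then T else tangle_sum T (int_tangle a).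

(* Continued fractions are given by their sequences [:: a_1; ...; a_r]. *)
Definition rational_tangle (s : seq nat) : tangle :=
  foldl (fun T a => add_int (tangle_inv T) a) (int_tangle (head 0 s)) (behead s).

Definition cf_value (s : seq nat) : rat :=
  foldl (fun v a => a%:R + v^-1)%R (head 0 s)%:R%R (behead s).

(* s = [:: a_1; ...; a_r] is a continued fraction of m/n with a_i > 0 for i < r
   and a_r >= 0. *)
Definition continued_fraction (m n : nat) (s : seq nat) : Prop :=
  [/\ s != [::], all (leq 1) (belast (head 0 s) (behead s))
    & cf_value s = (m%:R / n%:R)%R].

Definition numerator_closure (T : tangle) : pd :=
  [:: P (NE T) (NW T), P (SE T) (SW T) & nodes T].

(* The diagram obtained from a row of tangles placed side by side. *)
Definition montesinos (s : seq tangle) : pd :=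
  numerator_closure (foldl tangle_sum (head (int_tangle 0) s) (behead s)).

(* Main.v *)
(* If two arcs a, b represent the same element, then e_a - e_b is an integral
   combination, with coefficient f(c) at the crossing c, of the relations.  The
   diagram is alternating, so f is a function on the arcs through their
   overcrossings, and it is harmonic except for a unit source at a and a unit
   sink at b.  Let S be the set of crossings where f is maximal.  By
   integrality at most one edge leaves S from an overpass, hence at most one
   from an underpass, since S has as many overpassing as underpassing ends.
   But every cut of a Montesinos diagram that separates two crossings has at
   least 4 edges, so f is constant, and e_a = e_b. *)

From HB Require Import structures.
Require Import Defs.
From mathcomp Require Import all_boot all_order all_algebra ring_quotient.
From mathcomp Require Import boolp zify lra.

Set Implicit Arguments.
Unset Strict Implicit.
Unset Printing Implicit Defensive.

Import Order.TTheory GRing.Theory Num.Theory.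

(** * Functions on edge labels, under relabelling and reflection *)

Definition strand_constant (T : eqType) (phi : nat -> T) (v : node) : bool :=
  match v with X a b c d => phi b == phi d | P a b => phi a == phi b end.

Definition over_value (T : eqType) (phi : nat -> T) (v : node) (x : T) : bool :=
  match v with X a b c d => phi b == x | P _ _ => true end.

Lemma strand_constant_relabel (T : eqType) (phi : nat -> T) f v :
  strand_constant phi (relabel_node f v) = strand_constant (phi \o f) v.
Proof. by case: v. Qed.

Lemma over_value_relabel (T : eqType) (phi : nat -> T) f v x :
  over_value phi (relabel_node f v) x = over_value (phi \o f) v x.
Proof. by case: v. Qed.

Lemma strand_constant_reflect (T : eqType) (phi : nat -> T) v :
  strand_constant phi (reflect_node v) = strand_constant phi v.
Proof. by case: v => //= a b c d; rewrite eq_sym. Qed.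

Lemma over_value_reflect (T : eqType) (phi : nat -> T) v x : strand_constant phi v ->
  over_value phi (reflect_node v) x = over_value phi v x.
Proof. by case: v => //= a b c d /eqP ->. Qed.

Lemma all_strand_constant_relabel (T : eqType) (phi : nat -> T) f D :
  all (strand_constant phi) (relabel f D) = all (strand_constant (phi \o f)) D.
Proof. by rewrite all_map; apply: eq_all => v /=; rewrite strand_constant_relabel. Qed.

Lemma all_over_value_relabel (T : eqType) (phi : nat -> T) f D x :
  all ((over_value phi)^~ x) (relabel f D) = all ((over_value (phi \o f))^~ x) D.
Proof. by rewrite all_map; apply: eq_all => v /=; rewrite over_value_relabel. Qed.

(* G stands for a function on the arcs, that is, a strand-constant function on
   the edge labels; over_excess is its value on the crossing relation. *)
Definition over_excess (G : nat -> int) (v : node) : int :=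
  (if v is X a b c d then G b *+ 2 - G a - G c else 0)%R.

(* In an alternating diagram every edge joins an overpass to an underpass; each
   edge is charged to the crossing at its underpass, and has the colour of the
   crossing at its overpass. *)
Definition cut (g : nat -> bool) (v : node) : nat :=
  if v is X a b c d then (g b (+) g a) + (g b (+) g c) else 0.

Lemma over_excess_relabel G f v :
  over_excess G (relabel_node f v) = over_excess (G \o f) v.
Proof. by case: v. Qed.

Lemma cut_relabel g f v : cut g (relabel_node f v) = cut (g \o f) v.
Proof. by case: v. Qed.

Lemma over_excess_reflect G v : strand_constant G v ->
  over_excess G (reflect_node v) = over_excess G v.
Proof. by case: v => //= a b c d /eqP ->; rewrite addrAC. Qed.

Lemma cut_reflect g v : strand_constant g v -> cut g (reflect_node v) = cut g v.
Proof. by case: v => //= a b c d /eqP ->; rewrite addnC. Qed.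

(* The labels NE and SW end at overpasses inside T, so their values r and s are
   determined by w, while the values of NW and SE are free: this is why r and s
   are quantified before p and q. *)
Definition extendable (T : tangle) : Prop :=
  forall w : seq int, size w = size (nodes T) ->
  exists r s, forall p q, exists phi : nat -> int,
    [/\ phi (NW T) = p, phi (SE T) = q, phi (NE T) = r, phi (SW T) = s
      & all (strand_constant phi) (nodes T) && all2 (over_value phi) (nodes T) w].

(** Alternation in summed form: up to bivalent points, an inner edge counts +1 at its overpass and
    -1 at its underpass, so only the four ends survive. *)
Definition balanced (T : tangle) : Prop :=
  forall G : nat -> int, all (strand_constant G) (nodes T) ->
  (\sum_(v <- nodes T) over_excess G v = G (NE T) + G (SW T) - G (NW T) - G (SE T))%R.

(* The last two conjuncts say that a cheap cut with at most one end of the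
   minority colour does not separate any crossings; strengthening the bound in
   this way makes it stable under tangle sums. *)
Definition cut_bound (nw ne sw se : bool) (c : nat) (mono0 mono1 : bool) : bool :=
  let n := nw + ne + sw + se in
  [&& minn n (4 - n) <= c, (n <= 1) && (c + n <= 2) ==> mono0
    & (3 <= n) && (c + (4 - n) <= 2) ==> mono1].

Definition cut_bounded (T : tangle) : Prop :=
  forall g : nat -> bool, all (strand_constant g) (nodes T) ->
  cut_bound (g (NW T)) (g (NE T)) (g (SW T)) (g (SE T)) (\sum_(v <- nodes T) cut g v)
    (all ((over_value g)^~ false) (nodes T)) (all ((over_value g)^~ true) (nodes T)).

Lemma cut_bound_sum nw ne sw se x y c c' a0 a1 a0' a1' :
  cut_bound nw x sw y c a0 a1 -> cut_bound x ne y se c' a0' a1' ->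
  cut_bound nw ne sw se (c + c') (a0 && a0') (a1 && a1').
Proof.
by rewrite /cut_bound; case: nw; case: ne; case: sw; case: se; case: x; case: y => /=; lia.
Qed.

(** Both tangles see the same four edges. If the colours split 2-2, each cut costs at least 2, so
    the total is at least 4. If they split 3-1, both costs are exactly 1 and both tangles are
    monochromatic; with a single colour, cost at most 2 already suffices. *)
Lemma cut_bound_closure x y z t c c' a0 a1 a0' a1' :
  cut_bound z x t y c a0 a1 -> cut_bound x z y t c' a0' a1' ->
  c + c' <= 2 -> (a0 && a0') || (a1 && a1').
Proof. by rewrite /cut_bound; case: x; case: y; case: z; case: t => /=; lia. Qed.

Definition good T := [/\ extendable T, balanced T & cut_bounded T].

(** * Inversion of tangles *)

Lemma extendable_inv T : extendable T -> extendable (tangle_inv T).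
Proof.
move=> ext w; rewrite size_map => /ext [r [s extrs]].
exists s, r => p q; have [phi [hNW hSE hNE hSW /andP[sc ov]]] := extrs p q.
exists phi; split=> //=; apply/andP; split.
  by rewrite all_map; apply: sub_all sc => v /=; rewrite strand_constant_reflect.
elim: (nodes T) w sc ov {extrs} => [|v D IH] [|x w] //= /andP[scv scD] /andP[ovv ovD].
by rewrite over_value_reflect // ovv IH.
Qed.

Lemma balanced_inv T : balanced T -> balanced (tangle_inv T).
Proof.
move=> bal G /=; rewrite all_map (eq_all (strand_constant_reflect G)) => sc.
rewrite big_map (eq_big_seq (over_excess G)); last first.
  by move=> v /(allP sc); exact: over_excess_reflect.
by rewrite bal // [(G (SW T) + _)%R]addrC.
Qed.

Lemma cut_bounded_inv T : cut_bounded T -> cut_bounded (tangle_inv T).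
Proof.
move=> bnd g /=; rewrite !all_map (eq_all (strand_constant_reflect g)) => sc.
rewrite big_map (eq_big_seq (cut g)); last first.
  by move=> v /(allP sc); exact: cut_reflect.
have E x : all (preim reflect_node ((over_value g)^~ x)) (nodes T)
         = all ((over_value g)^~ x) (nodes T).
  by apply: eq_in_all => v /(allP sc) /(over_value_reflect x).
by rewrite !E; have := bnd g sc; rewrite /cut_bound (addnAC (g (NW T))).
Qed.

(** * Sums of tangles *)

Definition glue (A : Type) (phi psi : nat -> A) (x : nat) : A :=
  if odd x then psi x./2 else phi x./2.

Lemma glue_lft A (phi psi : nat -> A) x : glue phi psi (lft x) = phi x.
Proof. by rewrite /glue /lft odd_double doubleK. Qed.

Lemma glue_rgt A (phi psi : nat -> A) x : glue phi psi (rgt x) = psi x.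
Proof. by rewrite /glue /rgt /= odd_double uphalf_double. Qed.

Lemma eq_strand_constant (A : eqType) (phi psi : nat -> A) :
  phi =1 psi -> strand_constant phi =1 strand_constant psi.
Proof. by move=> E [a b c d|a b] /=; rewrite !E. Qed.

Lemma eq_over_value (A : eqType) (phi psi : nat -> A) :
  phi =1 psi -> over_value phi =2 over_value psi.
Proof. by move=> E [a b c d|a b] x /=; rewrite ?E. Qed.

Lemma all2_over_value_relabel (phi psi : nat -> int) f D w :
  phi \o f =1 psi -> all2 (over_value phi) (relabel f D) w = all2 (over_value psi) D w.
Proof.
move=> E; elim: D w => [|v D IH] [|x w] //=.
by rewrite IH over_value_relabel (eq_over_value E).
Qed.

Lemma all2_cat (A B : Type) (r : A -> B -> bool) s1 s2 t1 t2 : size s1 = size t1 ->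
  all2 r (s1 ++ s2) (t1 ++ t2) = all2 r s1 t1 && all2 r s2 t2.
Proof. by elim: s1 t1 => [|x s1 IH] [|y t1] //= [/IH ->]; rewrite andbA. Qed.

(** Each glued edge joins a forced end of one summand to a free end of the other: [r] at NE of [T]
    is fed to NW of [T'], and [s'] at SW of [T'] to SE of [T]. *)
Lemma extendable_sum T T' : extendable T -> extendable T' -> extendable (tangle_sum T T').
Proof.
move=> ext ext' [|x [|y w]] //=; rewrite size_cat !size_map => -[sz].
have szl : size (take (size (nodes T)) w) = size (nodes T).
  by rewrite size_takel // sz leq_addr.
have [r [s extrs]] := ext _ szl.
have szr : size (drop (size (nodes T)) w) = size (nodes T').
  by rewrite size_drop sz addKn.
have [r' [s' extrs']] := ext' _ szr.
exists r', s => p q.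
have [phi [hNW hSE hNE hSW /andP[sc ov]]] := extrs p s'.
have [phi' [hNW' hSE' hNE' hSW' /andP[sc' ov']]] := extrs' r q.
have El : glue phi phi' \o lft =1 phi by move=> z; rewrite /= glue_lft.
have Er : glue phi phi' \o rgt =1 phi' by move=> z; rewrite /= glue_rgt.
exists (glue phi phi'); split; rewrite ?glue_lft ?glue_rgt //.
rewrite hNE hNW' hSE hSW' !eqxx /= all_cat !all_strand_constant_relabel.
rewrite (eq_all (eq_strand_constant El)) (eq_all (eq_strand_constant Er)) sc sc' /=.
rewrite -[w](cat_take_drop (size (nodes T))) all2_cat ?size_map //.
by rewrite (all2_over_value_relabel _ _ El) (all2_over_value_relabel _ _ Er) ov ov'.
Qed.

Lemma balanced_sum T T' : balanced T -> balanced T' -> balanced (tangle_sum T T').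
Proof.
move=> bal bal' G /=; rewrite all_cat !all_strand_constant_relabel.
move=> /and4P[/eqP E1 /eqP E2 sc sc'].
rewrite !big_cons big_cat !big_map /=.
rewrite !(eq_bigr _ (fun v _ => over_excess_relabel G _ v)) bal // bal' //=.
by rewrite E1 E2; lra.
Qed.

Lemma cut_bounded_sum T T' : cut_bounded T -> cut_bounded T' -> cut_bounded (tangle_sum T T').
Proof.
move=> bnd bnd' g /=; rewrite !all_cat !all_strand_constant_relabel.
move=> /and4P[/eqP E1 /eqP E2 sc sc'].
rewrite !big_cons big_cat !big_map /= !all_over_value_relabel !add0n.
rewrite !(eq_bigr _ (fun v _ => cut_relabel g _ v)).
have := bnd' _ sc'; have := bnd _ sc; rewrite /= E1 E2; exact: cut_bound_sum.
Qed.

(** * Integer and rational tangles *)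

Lemma int_tangleS a : nodes (int_tangle a.+1) =
  rcons (nodes (int_tangle a)) (X a.*2 a.*2.+1 a.*2.+3 a.*2.+2).
Proof. by rewrite /int_tangle /nodes -[a.+1]addn1 iotaD map_cat cats1. Qed.

Lemma extendable_int a : extendable (int_tangle a.+1).
Proof.
move=> w; rewrite size_map size_iota => sz.
exists (nth 0%R w a), (nth 0%R w 0) => p q.
(* Labels 2i+1 and 2i+2 are the two ends of the overstrand of crossing i, and [l.-1./2] is i for
   both; the labels 0 and 2a+3 are the free ends NW and SE. *)
pose phi l := if l == 0 then p else if l == a.+1.*2.+1 then q else nth 0%R w l.-1./2.
have phiE i : i <= a -> phi i.*2.+1 = nth 0%R w i /\ phi i.*2.+2 = nth 0%R w i.
  move=> lei; rewrite /phi !ifF; try lia.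
  by rewrite /= uphalf_double doubleK.
exists phi; split.
- by [].
- by rewrite /phi /= !eqxx.
- exact: (phiE a (leqnn a)).2.
- exact: (phiE 0 isT).1.
apply/andP; split.
  apply/allP => v /mapP[i]; rewrite mem_iota => /andP[_ lti] -> /=.
  by have [-> ->] := phiE i lti.
have -> : w = [seq nth 0%R w i | i <- iota 0 a.+1].
  by rewrite -sz -/(mkseq _ _) mkseq_nth.
have E s : all (fun i => phi i.*2.+1 == nth 0%R w i) s ->
    all2 (over_value phi) [seq X i.*2 i.*2.+1 i.*2.+3 i.*2.+2 | i <- s] [seq nth 0%R w i | i <- s].
  by elim: s => //= i s IH /andP[-> /IH].
apply: E; apply/allP => i; rewrite mem_iota => /andP[_ lti].
by have [-> _] := phiE i lti.
Qed.

Lemma balanced_int a : balanced (int_tangle a).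
Proof.
elim: a => [|a IH] G; first by rewrite /= big_nil => _; lra.
rewrite int_tangleS all_rcons big_rcons => /andP[/= /eqP E /IH ->] /=.
by rewrite doubleS /= -E; lra.
Qed.

(** Appending a crossing is a sum with a one-crossing tangle, so [cut_bound_sum] leaves only a
    single crossing to check. *)
Lemma cut_bounded_int a : cut_bounded (int_tangle a.+1).
Proof.
elim: a => [|a IH] g; rewrite int_tangleS !all_rcons big_rcons => /andP[scv].
  by move/eqP: scv => /= <- _; rewrite big_nil /cut_bound; case: (g 0); case: (g 1); case: (g 3).
move=> /IH; move: (\sum_(v <- _) _)%R (all _ _) (all _ _) => c a0 a1.
move/eqP: scv; rewrite /= !doubleS => <-.
rewrite [_ && a0]andbC [_ && a1]andbC => H; apply: cut_bound_sum H _.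
by rewrite /cut_bound; case: (g _); case: (g _); case: (g _); case: (g _).
Qed.

Lemma good_int a : good (int_tangle a.+1).
Proof. by split; [exact: extendable_int | exact: balanced_int | exact: cut_bounded_int]. Qed.

Lemma good_inv T : good T -> good (tangle_inv T).
Proof.
by case=> *; split; [exact: extendable_inv | exact: balanced_inv | exact: cut_bounded_inv].
Qed.

Lemma good_sum T T' : good T -> good T' -> good (tangle_sum T T').
Proof.
case=> ? ? ? [? ? ?].
by split; [exact: extendable_sum | exact: balanced_sum | exact: cut_bounded_sum].
Qed.

Lemma good_rational m n s : 0 < m -> 0 < n -> continued_fraction m n s ->
  good (rational_tangle s).
Proof.
move=> m_gt0 n_gt0; case: s => [|[|a] s] [] //= _; last first.
  move=> _ _; rewrite /rational_tangle /=; elim: s (int_tangle _) (good_int a) => //= b s IH T gT.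
  apply: IH; rewrite /add_int; case: b => [|b] /=; first exact: good_inv.
  by apply: good_sum; [exact: good_inv | exact: good_int].
(* A first coefficient 0 must also be the last one; then m/n = 0, contradicting positivity. *)
case: s => //= _ /esym /eqP.
by rewrite /cf_value /= mulf_eq0 invr_eq0 !pnatr_eq0; lia.
Qed.

Lemma good_foldl s T : good T -> (forall T', List.In T' s -> good T') ->
  good (foldl tangle_sum T s).
Proof.
elim: s T => //= T' s IH T gT gs; apply: IH => [|T'' ?]; last by apply: gs; right.
by apply: good_sum => //; apply: gs; left.
Qed.

(** * Closed diagrams *)

Definition closed_extendable (D : pd) : Prop :=
  forall w : seq int, size w = size D -> exists phi : nat -> int,
  all (strand_constant phi) D && all2 (over_value phi) D w.

Definition closed_balanced (D : pd) : Prop :=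
  forall G : nat -> int, all (strand_constant G) D -> (\sum_(v <- D) over_excess G v = 0)%R.

(** Crossings are 4-valent, so cuts have even size and the bound 2 means fewer than four edges. *)
Definition four_edge_connected (D : pd) : Prop :=
  forall g : nat -> bool, all (strand_constant g) D -> \sum_(v <- D) cut g v <= 2 ->
  all ((over_value g)^~ false) D || all ((over_value g)^~ true) D.

Lemma closed_extendable_closure T : extendable T -> closed_extendable (numerator_closure T).
Proof.
move=> ext [|x [|y w]] //= [/ext [r [s extrs]]].
(* The closure joins the free ends NW and SE to NE and SW, so they take the values forced there. *)
have [phi [hNW hSE hNE hSW h]] := extrs r s.
by exists phi; rewrite hNE hNW hSE hSW !eqxx.
Qed.

Lemma closed_balanced_closure T : balanced T -> closed_balanced (numerator_closure T).
Proof.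
move=> bal G /= /and3P[/eqP E1 /eqP E2 sc].
by rewrite !big_cons bal //= E1 E2; lra.
Qed.

Lemma four_edge_connected_closure T T' : cut_bounded T -> cut_bounded T' ->
  four_edge_connected (numerator_closure (tangle_sum T T')).
Proof.
move=> bnd bnd' g /=; rewrite !all_cat !all_strand_constant_relabel.
move=> /and5P[/eqP E3 /eqP E4 /eqP E1 /eqP E2 /andP[sc sc']].
rewrite !big_cons big_cat !big_map /= !all_over_value_relabel !add0n.
rewrite !(eq_bigr _ (fun v _ => cut_relabel g _ v)).
have := bnd' _ sc'; have := bnd _ sc; rewrite /= E1 E2 E3 E4; exact: cut_bound_closure.
Qed.

Definition over_label (phi : nat -> int) (v : node) : int :=
  (if v is X _ b _ _ then phi b else 0)%R.

(** * The maximum argument *)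

Lemma seq_maximum (s : seq int) : s != [::] ->
  exists2 M, M \in s & {in s, forall x, x <= M}%R.
Proof.
elim: s => // x [|y s] IH _; first by exists x => [|z]; rewrite inE // => /eqP ->.
have [//|M sM maxM] := IH; exists (Num.max x M).
  by case: leP => _; rewrite inE ?eqxx ?sM ?orbT.
move=> z; rewrite inE le_max => /predU1P[->|/maxM ->]; by rewrite ?lexx ?orbT.
Qed.

(** The hypothesis is tested on the indicator [G] of the set where [phi] attains its maximum M.
    Doubling and subtracting 2M-1 gives the integral weight 2 phi - (2M-1), which is 1 on that set
    and at most -1 off it. *)
Lemma over_label_constant D phi x y :
  closed_balanced D -> four_edge_connected D -> all (strand_constant phi) D ->
  (forall G, all (strand_constant G) D ->
     \sum_(v <- D) over_label phi v * over_excess G v = G x - G y)%R ->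
  exists M, {in D, forall v, is_crossing v -> over_label phi v = M}.
Proof.
move=> bal conn sc Hphi.
have [noX|] := eqVneq [seq over_label phi v | v <- D & is_crossing v] [::].
  exists 0%R => v Dv Xv; have : over_label phi v \in [::]; last by [].
  by rewrite -noX map_f // mem_filter Xv.
move=> /seq_maximum[M /mapP[v0]]; rewrite mem_filter => /andP[Xv0 Dv0] Mv0 maxM.
exists M; pose g l := phi l == M; pose G l := Posz (g l).
have scg : all (strand_constant g) D.
  by apply: sub_all sc => -[a b c d|a b] /eqP E; rewrite /= /g E.
have scG : all (strand_constant G) D.
  by apply: sub_all scg => -[a b c d|a b] /eqP E; rewrite /= /G E.
(* Where g holds this is an equality; elsewhere the integrality of phi gives
   over_label phi v <= M - 1. *)
have cut_le v : v \in D -> (Posz (cut g v) <=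
    2 * (over_label phi v * over_excess G v) - (2 * M - 1) * over_excess G v)%R.
  case: v => [a b c d|a b] Dv /=; last by rewrite !mulr0.
  have : (phi b <= M)%R by apply: maxM; apply/mapP; exists (X a b c d); rewrite ?mem_filter.
  rewrite /G /g; case: (eqVneq (phi b) M) => [->|neq] le_bM.
    by case: (phi a == M); case: (phi c == M) => /=; lia.
  by case: (phi a == M); case: (phi c == M) => /=; lia.
(* Balance makes the term with factor 2M-1 sum to zero. *)
have : (Posz (\sum_(v <- D) cut g v)%N <= 2 * (G x - G y))%R.
  have -> : (2 * (G x - G y) = \sum_(v <- D) (2 * (over_label phi v * over_excess G v)
      - (2 * M - 1) * over_excess G v))%R.
    by rewrite sumrB -!mulr_sumr bal // Hphi // mulr0 subr0.
  rewrite (big_morph Posz PoszD (erefl _)) big_seq [leRHS]big_seq.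
  exact: ler_sum.
have : (G x - G y <= 1)%R by rewrite /G; case: (g x); case: (g y).
move=> le1 le2; have {le1 le2} le2 : \sum_(v <- D) cut g v <= 2 by lia.
(* The all-false alternative fails at [v0], where the maximum is attained. *)
have /orP[/allP h|/allP h] := conn g scg le2.
  move: (h v0 Dv0) Xv0 Mv0; case: (v0) => //= a b c d.
  by rewrite /g => + _ Eb; rewrite Eb eqxx.
by case=> // a b c d /h /=; rewrite /g eqb_id => /eqP.
Qed.

(** A constant coefficient factors out of the sum, and the total excess vanishes by balance. *)
Lemma separation D phi x y :
  closed_balanced D -> four_edge_connected D -> all (strand_constant phi) D ->
  (forall G, all (strand_constant G) D ->
     \sum_(v <- D) over_label phi v * over_excess G v = G x - G y)%R ->
  forall G : nat -> int, all (strand_constant G) D -> G x = G y.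
Proof.
move=> bal conn sc Hphi G scG; apply/eqP; rewrite -subr_eq0 -Hphi //.
have [M HM] := over_label_constant bal conn sc Hphi.
rewrite (eq_big_seq (fun v => M * over_excess G v)%R).
  by rewrite -mulr_sumr bal // mulr0.
by case=> [a b c d|a b] Dv; [rewrite HM | rewrite /= !mulr0].
Qed.

(** * From darts and arcs to edge labels *)

Lemma strand_sym D : symmetric (@strand D).
Proof. by move=> d e; rewrite /strand /= eq_sym orbAC. Qed.

Lemma across_label D (G : nat -> int) (d : dart D) :
  all (strand_constant G) D -> ~~ under d -> G (label (across d)) = G (label d).
Proof.
move=> /allP sc; case: d => i j.
have := sc _ (mem_tnth i (in_tuple D)); rewrite -/(node_at i).
rewrite /under /across /label /at_crossing /node_of /=.
case E: is_crossing => /=; move: j E; case: (node_at i) => //=.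
  by move=> a b c d [[|[|[|[|]]]]] //= _ _ /eqP ->.
by move=> a b [[|[|]]] //= _ _ /eqP ->.
Qed.

Lemma strand_label D (G : nat -> int) (d e : dart D) :
  all (strand_constant G) D -> connect (@strand D) d e -> G (label d) = G (label e).
Proof.
move=> sc /connectP[p dp ->] {e}; elim: p d dp => //= e p IH d /andP[de /IH <-].
case/orP: de => [/orP[/eqP ->//|]|] /andP[nu /eqP ->]; by rewrite across_label.
Qed.

Lemma under_label D (G : nat -> int) (d : dart D) :
  all (strand_constant G) D -> under d ->
  (G (label (rot_ccw d)) *+ 2 - G (label d) - G (label (across d)))%R
    = over_excess G (node_of d).
Proof.
move=> /allP sc; case: d => i j.
have := sc _ (mem_tnth i (in_tuple D)); rewrite -/(node_at i).
rewrite /under /across /label /at_crossing /node_of /=.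
case E: is_crossing => //=; move: j E; case: (node_at i) => //=.
move=> a b c d [[|[|[|[|]]]]] //= _ _ /eqP E _; by rewrite -E addrAC.
Qed.

(** For strand-constant [G] the picked dart is irrelevant; the default 0 is never reached, since
    arcs are nonempty. *)
Definition arc_value D (G : nat -> int) (A : Arc D) : int :=
  if [pick d in val A] is Some d then G (label d) else 0%R.

Lemma arc_value_arc_of D G (d : dart D) : all (strand_constant G) D ->
  arc_value G (arc_of d) = G (label d).
Proof.
move=> sc; rewrite /arc_value /=; case: pickP => [e|/(_ d)]; rewrite inE.
  by move/(strand_label sc).
by rewrite connect0.
Qed.

Lemma arc_ofP D (A : Arc D) : exists d, A = arc_of d.
Proof. by have /imsetP[d _ Ad] := valP A; exists d; apply: val_inj. Qed.

(** * Linear forms on the free group of arcs, and equality in the quotients *)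

Section Evaluation.
Local Open Scope ring_scope.
Variables (D : pd) (G : nat -> int).

Definition arc_eval (v : {ffun Arc D -> int}) : int := \sum_A v A * arc_value G A.

Lemma arc_eval_is_zmod_morphism : zmod_morphism arc_eval.
Proof.
by move=> u v; rewrite /arc_eval -sumrB; apply: eq_bigr => A _; rewrite !ffunE mulrBl.
Qed.
HB.instance Definition _ :=
  GRing.isZmodMorphism.Build {ffun Arc D -> int} int arc_eval arc_eval_is_zmod_morphism.

Lemma arc_eval_gen A : arc_eval (free_gen A) = arc_value G A.
Proof.
rewrite /arc_eval (bigD1 A) //= ffunE eqxx mul1r big1 ?addr0 // => B.
by rewrite ffunE eq_sym => /negbTE ->; rewrite mul0r.
Qed.

Lemma arc_eval_relation d : all (strand_constant G) D ->
  arc_eval (crossing_relation d) = over_excess G (node_of (val d)).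
Proof.
move=> sc; rewrite !raddfB raddfMn /= !arc_eval_gen !arc_value_arc_of //.
exact/under_label/valP.
Qed.
End Evaluation.

Section SpanQuotient.
Local Open Scope ring_scope.
Variables (V : zmodType) (I : finType) (g : I -> V).

Lemma span_proj_is_zmod_morphism : zmod_morphism (span_proj g).
Proof. by move=> x y; rewrite /span_proj raddfB. Qed.
HB.instance Definition _ :=
  GRing.isZmodMorphism.Build V (span_quot g) (span_proj g) span_proj_is_zmod_morphism.

Lemma span_proj_eq x y : span_proj g x = span_proj g y ->
  exists c : I -> int, x - y = \sum_i g i *~ c i.
Proof. by move/eqP; rewrite /span_proj -Quotient.idealrBE => /asboolP. Qed.
End SpanQuotient.

(** The constant function 1 kills every crossing relation but is 1 on each arc, so the multiple of
    [a0] allowed by the quotient must be zero. *)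
Lemma arc_elt_eq D (a0 a b : Arc D) : arc_elt a0 a = arc_elt a0 b ->
  exists c : {d : dart D | under d} -> int,
    (free_gen a - free_gen b = \sum_d crossing_relation d *~ c d)%R.
Proof.
move=> /span_proj_eq[n]; rewrite (bigD1 tt) //= big1 ?addr0; last by case.
move: (n tt) => {}n; rewrite /col_elt -raddfB -raddfMz => /span_proj_eq[c E].
suff n0 : n = 0%R by exists c; rewrite -E n0 mulr0z subr0.
have sc : all (strand_constant (fun=> 1%R : int)) D by apply/allP => -[].
have Z : arc_eval (fun=> 1%R) (\sum_d crossing_relation d *~ c d)%R = 0%R.
  rewrite raddf_sum big1 // => d _; rewrite raddfMz /= arc_eval_relation //.
  by case: (node_of _) => * /=; rewrite mul0rz.
move/(congr1 (arc_eval (fun=> 1%R))): E; rewrite {}Z !raddfB raddfMz /= !arc_eval_gen.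
have [da ->] := arc_ofP a; have [db ->] := arc_ofP b; have [d0 ->] := arc_ofP a0.
by rewrite !arc_value_arc_of // subrr sub0r => /eqP; rewrite oppr_eq0 intz => /eqP.
Qed.

Lemma all2_nth (A B : Type) (x0 : A) (y0 : B) (r : A -> B -> bool) s t i :
  all2 r s t -> i < size s -> r (nth x0 s i) (nth y0 t i).
Proof. by elim: s t i => [|x s IH] [|y t] [|i] //= /andP[// rxy /IH]; apply. Qed.

Lemma arc_of_connect D (d e : dart D) : connect (@strand D) d e -> arc_of d = arc_of e.
Proof.
move=> de; apply/val_inj/setP => f; rewrite !inE.
by apply: same_connect de _; apply/sym_connect_sym/strand_sym.
Qed.

Lemma strand_dart D v : v \in D -> exists d : dart D, ~~ under d /\
  match v with
  | X _ b _ e => label d = b /\ label (across d) = e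
  | P a b => label d = a /\ label (across d) = b
  end.
Proof.
move=> /seq_tnthP[i]; rewrite -/(node_at i) => Ev.
case: v Ev => [a b c e|a b] /esym Ev.
  have lt1 : 1 < size (slots (node_at i)) by rewrite Ev.
  exists (Tagged (fun i => 'I_(size (slots (node_at i)))) (Ordinal lt1)).
  have Xi : is_crossing (node_at i) by rewrite Ev.
  by rewrite /under /across /label /at_crossing /node_of /= Xi /= Ev.
have lt0 : 0 < size (slots (node_at i)) by rewrite Ev.
exists (Tagged (fun i => 'I_(size (slots (node_at i)))) (Ordinal lt0)).
have Xi : is_crossing (node_at i) = false by rewrite Ev.
by rewrite /under /across /label /at_crossing /node_of /= Xi /= Ev.
Qed.

(** * Separation of arcs *)

Definition arc_indicator D (A : Arc D) (l : nat) : int :=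
  Posz [exists d : dart D, (label d == l) && (arc_of d == A)].

Lemma arc_indicator_label D (A : Arc D) d :
  arc_indicator A (label d) = Posz (arc_of d == A).
Proof.
congr (Posz (nat_of_bool _)); apply/existsP/eqP => [[e /andP[/eqP ed /eqP <-]]|<-].
  by apply/arc_of_connect/connect1/orP; left; apply/orP; left; rewrite ed.
by exists d; rewrite !eqxx.
Qed.

Lemma arc_indicator_constant D (A : Arc D) : all (strand_constant (arc_indicator A)) D.
Proof.
apply/allP => v /strand_dart[d [nu Ev]].
have : arc_indicator A (label d) == arc_indicator A (label (across d)).
  rewrite !arc_indicator_label (@arc_of_connect _ d (across d)) //.
  by apply/connect1/orP; left; apply/orP; right; rewrite nu eqxx.
by case: v Ev => [a b c e|a b] /= [-> ->].
Qed.

Lemma injective_arcs D : closed_extendable D -> closed_balanced D -> four_edge_connected D ->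
  forall a0 a b : Arc D, a <> b -> arc_elt a0 a <> arc_elt a0 b.
Proof.
move=> ext bal conn a0 a b neq_ab /arc_elt_eq[c E]; apply: neq_ab.
(* The two undercrossing darts of a crossing give the same relation, so their coefficients are
   added. *)
pose F i : int := (\sum_(d | tag (val d) == i) c d)%R.
(* Extendability turns the crossing coefficients into a function on arcs, read at overpasses. *)
have [|phi /andP[sc ov]] := ext [seq F i | i <- enum 'I_(size D)].
  by rewrite size_map size_enum_ord.
have [da defa] := arc_ofP a; have [db defb] := arc_ofP b.
have Hphi G : all (strand_constant G) D ->
    (\sum_(v <- D) over_label phi v * over_excess G v = G (label da) - G (label db))%R.
  move=> scG; rewrite -!(arc_value_arc_of _ scG) -defa -defb -!arc_eval_gen -raddfB E.
  rewrite raddf_sum big_tnth [RHS](partition_big (fun d => tag (val d)) predT) //=.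
  apply: eq_bigr => i _; rewrite -/(node_at i).
  have : over_value phi (node_at i) (F i).
    have := all2_nth (P 0 0) 0%R ov (ltn_ord i).
    by rewrite (nth_map i) ?size_enum_ord // nth_ord_enum /node_at (tnth_nth (P 0 0)).
  have -> : (\sum_(d | tag (val d) == i) arc_eval G (crossing_relation d *~ c d)
      = F i * over_excess G (node_at i))%R.
    rewrite mulr_suml; apply: eq_bigr => d /eqP <-.
    by rewrite raddfMz /= arc_eval_relation // -mulrzl intz.
  by case: (node_at i) => //= [p q r s /eqP -> //|p q _]; rewrite !mulr0.
(* The indicator of [a] is 1 at [da], hence also at [db], which places [db] on [a]. *)
have scG := arc_indicator_constant a.
have := separation bal conn sc Hphi scG.
by rewrite !arc_indicator_label -defa eqxx defb -defb; case: eqVneq => // ->.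
Qed.

(** The closure bound concerns a sum of two tangles, so the last tangle is split off and the others
    are summed; this uses that there are at least two. *)
Lemma injective_arcs_montesinos s : 2 <= size s -> (forall T, List.In T s -> good T) ->
  forall a0 a b : Arc (montesinos s), a <> b -> arc_elt a0 a <> arc_elt a0 b.
Proof.
case: s => [|T s] //; case/lastP: s => // s T' _ gs.
have gT : good T by apply: gs; left.
have gT' : good T'.
  by apply: gs; right; rewrite -cats1; apply/List.in_or_app; right; left.
have gS : good (foldl tangle_sum T s).
  apply: good_foldl => // T'' T''s.
  by apply: gs; right; rewrite -cats1; apply/List.in_or_app; left.
rewrite /montesinos /= -cats1 foldl_cat /=.
have [ext bal _] := good_sum gS gT'; have [_ _ bnd] := gS; have [_ _ bnd'] := gT'.
apply: injective_arcs.
- exact: closed_extendable_closure.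
- exact: closed_balanced_closure.
- exact: four_edge_connected_closure.
Qed.

Theorem theorem9 (k : nat) (m n : 'I_k -> nat) (cf : 'I_k -> seq nat) :
  2 <= k ->
  (forall i, 0 < m i <= n i) ->
  (forall i, coprime (m i) (n i)) ->
  (forall i, continued_fraction (m i) (n i) (cf i)) ->
  let L := montesinos [seq rational_tangle (cf i) | i <- enum 'I_k] in
  represents_prime_link L ->
  ~~ has_nugatory_crossing L ->
  forall a0 a b : Arc L, a <> b -> arc_elt a0 a <> arc_elt a0 b.
Proof.
move=> k_ge2 mn _ cfP L _ _; apply: injective_arcs_montesinos.
  by rewrite size_map size_enum_ord.
move=> T /List.in_map_iff[i [<- _]]; have /andP[m_gt0 le_mn] := mn i.
exact: good_rational m_gt0 (leq_trans m_gt0 le_mn) (cfP i).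
Qed.
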